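(* Let $\{x_k\}$ be a sequence of real numbers converging to $x_*$ with $x_k \neq x_*$ for all large $k$. If $\{x_k\}$ converges with $p$-step Q-order at least $\alpha$ for some step $p \in \mathbb{N}$ and some order $\alpha \geq 1$, then for every $m \in \mathbb{N}$ it converges with $mp$-step Q-order at least $\alpha$.
   Context: $\mathbb{N} = \{1,2,\dots\}$; sequences are indexed by integers $k \geq 0$. For a sequence $\{x_k\}$ of real numbers converging to $x_*$, with $x_k \neq x_*$ for all large $k$, put $e_k = |x_k - x_*|$. All quotients below are considered for $k$ large enough that they are defined, and limits superior are taken in $[0,+\infty]$. For $p \in \mathbb{N}$ and $\alpha \geq 1$ define $$Q_1^{(p)}(x_k) = \left(\frac{e_{k+p}}{e_k}\right)^{1/p}, \qquad Q_\alpha^{(p)}(x_k) = \left(\frac{e_{k+p}}{e_k^{\alpha^p}}\right)^{\frac{\alpha-1}{\alpha^p-1}} \ \text{ if } \alpha>1, \qquad \overline{Q}_\alpha^{(p)}(x_k) = \limsup_{k\to\infty} Q_\alpha^{(p)}(x_k).$$ The sequence $\{x_k\}$ converges with $p$-step Q-order at least $1$ if $\overline{Q}_1^{(p)}(x_k) < 1$, and with $p$-step Q-order at least $\alpha$, for $\alpha > 1$, if $\overline{Q}_\alpha^{(p)}(x_k) < \infty$. *)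

(* Defs.v *)
From HB Require Import structures.
From mathcomp Require Import all_boot all_order all_algebra.
From mathcomp Require Import all_classical all_reals all_analysis.
Set Implicit Arguments.
Unset Strict Implicit.
Unset Printing Implicit Defensive.
Import Order.TTheory GRing.Theory Num.Theory.
Import numFieldNormedType.Exports.
Local Open Scope classical_set_scope.
Local Open Scope ring_scope.

Definition err (R : realType) (x : nat -> R) (xstar : R) (k : nat) : R :=
  `|x k - xstar|.

(* Meaningful for 0 < p and 1 <= alpha. At an index k with x k = xstar the
   quotient takes a conventional real value; only finitely many indices are
   concerned when x k != xstar for all large k, so the limit superior below
   is unaffected. *)
Definition Qfactor (R : realType) (p : nat) (alpha : R)
    (x : nat -> R) (xstar : R) (k : nat) : R :=
  if alpha == 1
  then (err x xstar (k + p) / err x xstar k) `^ (1 / p%:R)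
  else (err x xstar (k + p) / err x xstar k `^ (alpha ^+ p))
         `^ ((alpha - 1) / (alpha ^+ p - 1)).

Definition Qfactor_sup (R : realType) (p : nat) (alpha : R)
    (x : nat -> R) (xstar : R) : \bar R :=
  limn_esup (fun k => (Qfactor p alpha x xstar k)%:E).

Definition Qorder_at_least (R : realType) (p : nat) (alpha : R)
    (x : nat -> R) (xstar : R) : Prop :=
  if alpha == 1 then (Qfactor_sup p alpha x xstar < 1)%E
  else (Qfactor_sup p alpha x xstar < +oo)%E.

(* Main.v *)
(** Whatever [alpha >= 1], [p]-step Q-order at least [alpha] means that
    eventually [e (k + p) <= D * e k `^ (alpha ^ p)] for some [D >= 0], with
    [D < 1] in the linear case [alpha = 1].  Composing such bounds with
    constants [C] and [D] gives one with constant [D * C `^ t], where [t] is the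
    exponent of the second; for [alpha = 1] this is [D * C < 1]. *)

Require Import Defs.
From HB Require Import structures.
From mathcomp Require Import all_boot all_order all_algebra.
From mathcomp Require Import all_classical all_reals all_analysis.
Import Order.TTheory GRing.Theory Num.Theory.
Import numFieldNormedType.Exports.
Local Open Scope classical_set_scope.
Local Open Scope ring_scope.

(** The limit superior is an infimum of suprema over neighbourhoods of infinity, so a strict bound
    is already attained on one of them. Keeping [c] extended treats the bounds [1] and [+oo] at
    once. *)
Lemma limn_esup_lt (R : realType) (u : nat -> R) (c : \bar R) :
  (limn_esup (fun k => (u k)%:E) < c)%E <->
  exists q : R, (q%:E < c)%E /\ \forall k \near \oo, u k <= q.
Proof.
split=> [/ereal_inf_lt[_ [V Voo <-] Vc]|[q [qc uq]]].
  have uV k : V k -> ((u k)%:E <= ereal_sup ((EFin \o u) @` V))%E.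
    by move=> Vk; apply: ereal_sup_ubound; exists k.
  have [k0 Vk0] := filter_ex Voo.
  (* Nonemptiness of [V] keeps the supremum above [-oo]; lying below [c] keeps it below [+oo]. *)
  have supfin : ereal_sup ((EFin \o u) @` V) \is a fin_num.
    by rewrite fin_real// (lt_le_trans (ltNyr _) (uV _ Vk0)) (lt_le_trans Vc) ?leey.
  exists (fine (ereal_sup ((EFin \o u) @` V))); split; first by rewrite fineK.
  by apply: filterS Voo => k /uV; rewrite -lee_fin fineK.
apply: le_lt_trans qc; apply: ereal_inf_le.
exists (ereal_sup ((EFin \o u) @` [set k | u k <= q])); first by exists [set k | u k <= q].
by apply: ge_ereal_sup => _ [k /= ukq <-]; rewrite lee_fin.
Qed.

(** The maps [y]^ s[and]y [^ s^-1] are increasing on nonnegative reals and fix 1, so the outer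
    exponent of a Q-factor affects neither boundedness nor a bound below 1. The flag [b] marks the
    linear case. *)
Lemma limn_esup_powR_lt {R : realType} {u : nat -> R} {s : R} {b : bool} :
  0 < s -> (forall k, 0 <= u k) ->
  (limn_esup (fun k => (u k `^ s)%:E) < if b then 1 else +oo)%E <->
  exists D : R, [/\ 0 <= D, b -> D < 1 & \forall k \near \oo, u k <= D].
Proof.
have powR_lt1 (r y : R) : 0 < r -> 0 <= y -> y < 1 -> y `^ r < 1.
  move=> r0 y0 y1; rewrite -[ltRHS](congr1 (@^~ r) (@powR1 R)).
  by apply: gt0_ltr_powR; rewrite ?nnegrE.
move=> s0 u0; split=> [/limn_esup_lt[q [qc uq]]|[D [D0 D1 uD]]].
  have q0 : 0 <= q by have [k] := filter_ex uq; exact: le_trans (powR_ge0 _ _).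
  exists (q `^ s^-1); split; first exact: powR_ge0.
    by move=> bT; apply: powR_lt1; rewrite ?invr_gt0//; rewrite bT lte_fin in qc.
  apply: filterS uq => k ukq.
  rewrite -[leLHS]powRr1// -(divff (lt0r_neq0 s0)) powRrM.
  by apply: ge0_ler_powR; rewrite ?nnegrE ?invr_ge0 ?powR_ge0// ltW.
apply/limn_esup_lt; exists (D `^ s); split.
  by case: b D1 => [/(_ isT) D1|_]; [rewrite lte_fin powR_lt1 | rewrite ltry].
apply: filterS uD => k ukD.
by apply: ge0_ler_powR; rewrite ?nnegrE// ltW.
Qed.

Lemma err_ge0 (R : realType) (x : nat -> R) (xstar : R) (k : nat) :
  0 <= err x xstar k.
Proof. exact: normr_ge0. Qed.

Lemma Qorder_at_leastP {R : realType} {p : nat} {alpha : R} {x : nat -> R}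
    {xstar : R} :
  (\forall k \near \oo, x k != xstar) -> (0 < p)%N -> 1 <= alpha ->
  Qorder_at_least p alpha x xstar <->
  exists D : R, [/\ 0 <= D, alpha == 1 -> D < 1 &
    \forall k \near \oo,
      err x xstar (k + p) <= D * err x xstar k `^ (alpha ^+ p)].
Proof.
move=> x_neq p_gt0 alpha_ge1.
(* For [alpha = 1] the exponent [alpha ^+ p] is 1, so one quotient [u] serves both cases and only
   the outer exponent [s] depends on the case. *)
pose u k := err x xstar (k + p) / err x xstar k `^ (alpha ^+ p).
pose s := if alpha == 1 then 1 / p%:R else (alpha - 1) / (alpha ^+ p - 1).
have s0 : 0 < s.
  rewrite /s; case: eqVneq => [_|alpha1]; first by rewrite divr_gt0// ltr0n.
  have alpha_gt1 : 1 < alpha by rewrite lt_neqAle eq_sym alpha1.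
  by rewrite divr_gt0 ?subr_gt0// exprn_egt1// -lt0n.
have u0 k : 0 <= u k by rewrite divr_ge0 ?err_ge0 ?powR_ge0.
have -> : Qorder_at_least p alpha x xstar =
    (limn_esup (fun k => (u k `^ s)%:E) < if (alpha == 1)%R then 1 else +oo)%E.
  rewrite /Qorder_at_least /Qfactor_sup.
  have -> : Qfactor p alpha x xstar = fun k => u k `^ s.
    apply/funext => k; rewrite /Qfactor /u /s.
    by case: eqVneq => // ->; rewrite expr1n powRr1// err_ge0.
  by case: ifP.
(* Where [x k != xstar] the denominator is positive and can be cleared. *)
have uD D : (\forall k \near \oo, u k <= D) <-> \forall k \near \oo,
    err x xstar (k + p) <= D * err x xstar k `^ (alpha ^+ p).
  split; apply: filterS2 x_neq => k xk;
    by rewrite ler_pdivrMr// powR_gt0// normr_gt0 subr_eq0.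
split=> [/(limn_esup_powR_lt s0 u0)|] [D [D0 D1 /uD hD]].
  by exists D.
by apply/(limn_esup_powR_lt s0 u0); exists D.
Qed.

Lemma near_infty_addr {P : set nat} (n : nat) :
  (\forall k \near \oo, P k) -> \forall k \near \oo, P (k + n)%N.
Proof.
move=> [N _ NP]; exists N => // k Nk.
by apply: NP; exact: leq_trans Nk (leq_addr _ _).
Qed.

(** The second bound is used at [k + a], and the first, raised to the power [t], is inserted into
    it. *)
Lemma step_bound_comp (R : realType) (e : nat -> R) (a b : nat) (C D r t : R) :
  (forall k, 0 <= e k) -> 0 <= C -> 0 <= D -> 0 <= t ->
  (\forall k \near \oo, e (k + a)%N <= C * e k `^ r) ->
  (\forall k \near \oo, e (k + b)%N <= D * e k `^ t) ->
  \forall k \near \oo, e (k + (a + b))%N <= D * C `^ t * e k `^ (r * t).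
Proof.
move=> e0 C0 D0 t0 eC /(near_infty_addr a) eD.
apply: filterS2 eC eD => k ekC; rewrite -addnA => /le_trans; apply.
rewrite -mulrA ler_wpM2l// powRrM -powRM ?powR_ge0//.
by apply: ge0_ler_powR; rewrite ?nnegrE ?mulr_ge0 ?powR_ge0.
Qed.

Theorem proposition5 (R : realType) (x : nat -> R) (xstar : R)
  (x_cvg : x @ \oo --> xstar)
  (x_neq : \forall k \near \oo, x k != xstar)
  (p : nat) (p_gt0 : (0 < p)%N) (alpha : R) (alpha_ge1 : 1 <= alpha)
  (x_order : Qorder_at_least p alpha x xstar) :
  forall m : nat, (0 < m)%N -> Qorder_at_least (m * p) alpha x xstar.
Proof.
move: x_order => /(Qorder_at_leastP x_neq p_gt0 alpha_ge1)[C [C0 C1 eC]].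
(* The induction starts at one block of [p] steps: over zero steps [D < 1] would fail. *)
move=> [|m] m_gt0; first by rewrite ltnn in m_gt0.
apply/Qorder_at_leastP; rewrite ?muln_gt0//.
elim: m {m_gt0} => [|m [D [D0 D1 eD]]]; first by exists C; rewrite mul1n.
(* The first [p] steps cost [C] and the remaining [m.+1 * p] cost [D], so the power falls on [C]. *)
exists (D * C `^ (alpha ^+ (m.+1 * p))); split.
- by rewrite mulr_ge0 ?powR_ge0.
- move=> alpha1; rewrite (eqP alpha1) expr1n powRr1//.
  by rewrite mulr_ilt1 ?D1 ?C1.
- rewrite mulSn exprD; apply: step_bound_comp => //.
  + by move=> k; exact: err_ge0.
  + by rewrite exprn_ge0// (le_trans ler01).
Qed.
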